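(* Let $\lambda_0>\Theta>0$ and assume that $$C:=\sup_{x\in B_1}\int_{B_1}(1-|y|^2)\,K(x,y)\,dy<+\infty.$$ Let $u$ be a solution of $$\partial_t u(x,t)=c\Delta u(x,t)+\int_{B_1}\big(u(y,t)-\Theta\big)_+\,K(x,y)\,dy\qquad\text{in }B_1\times(0,+\infty),$$ with $u(x,t)=0$ for all $x\in\partial B_1$ and $t\in[0,+\infty)$. Suppose that $$u(x,0)\le\lambda_0(1-|x|^2)\qquad\text{for all }x\in B_1.$$ If $$c>\frac{C}{2n},$$ then, for all $x\in B_1$, $$\lim_{t\to+\infty}u(x,t)\le0,$$ and, more precisely, for all $x\in B_1$ and $t\in[0,+\infty)$, $$u(x,t)\le\lambda_0e^{-(2nc-C)t}(1-|x|^2).$$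
   Context: $B_1\subset\mathbb{R}^n$ is the open unit ball centered at the origin, $c\in(0,+\infty)$, and $r_+:=\max\{r,0\}$ for $r\in\mathbb{R}$. The Laplacian $\Delta$ acts in the space variable $x$. The kernel $K:B_1\times B_1\to[0,+\infty)$ is measurable, nonnegative and integrable, with $\sup_{x\in B_1}\int_{B_1}K(x,y)\,dy<+\infty$. Solutions are classical: $u:\overline{B_1}\times[0,+\infty)\to\mathbb{R}$ is continuous, for every $x\in B_1$ the map $(0,+\infty)\ni t\mapsto u(x,t)$ is continuously differentiable, and for every $t\in(0,+\infty)$ the map $B_1\ni x\mapsto u(x,t)$ is twice continuously differentiable. *)

(* Defs.v *)
From HB Require Import structures.
From mathcomp Require Import all_boot all_order all_algebra.
From mathcomp Require Import all_classical all_reals all_analysis.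

Set Implicit Arguments.
Unset Strict Implicit.
Unset Printing Implicit Defensive.

Import Order.TTheory GRing.Theory Num.Theory.
Import numFieldNormedType.Exports.

Local Open Scope classical_set_scope.
Local Open Scope ring_scope.

(* The library's Lebesgue measure lives on the line. On R^n, represented by
   row vectors, we take the textbook construction: the outer measure generated
   by the volume of half-open boxes, restricted to its Caratheodory
   sigma-algebra; this is the complete Lebesgue measure. *)
Section lebesgue_measure_rV.
Variables (R : realType) (n : nat).

Definition box (a b : 'rV[R]_n) : set 'rV[R]_n :=
  [set x | forall i, a 0 i < x 0 i <= b 0 i].

(* [mu_ext] ranges over covers by measurable sets of its carrier and needs a
   set function defined on all sets: a set that is not a box gets volume +oo
   (the infimum of the empty set), so that only covers by boxes matter. A
   nonempty box determines [a] and [b] and gets its usual volume. *)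
Definition box_space := g_sigma_algebraType (range (uncurry box)).

Definition box_volume (A : set box_space) : \bar R :=
  if A == set0 then 0%E
  else ereal_inf [set (\prod_(i < n) (ab.2 0 i - ab.1 0 i))%:E |
                   ab in [set ab : 'rV[R]_n * 'rV[R]_n | A = box ab.1 ab.2]].

Lemma box_volume0 : box_volume set0 = 0%E.
Proof. by rewrite /box_volume eqxx. Qed.

Lemma box_volume_ge0 A : (0 <= box_volume A)%E.
Proof.
rewrite /box_volume; case: ifPn => // /set0P[x Ax].
apply: le_ereal_inf_tmp => _ [[a b] /= AE <-].
rewrite lee_fin; apply: prodr_ge0 => i _.
have : box a b x by rewrite -AE.
by move=> /(_ i) /andP[/ltW ax xb]; rewrite subr_ge0 (le_trans ax).
Qed.

Definition lebesgue_outer : set box_space -> \bar R := mu_ext box_volume.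

Let outer0 : lebesgue_outer set0 = 0%E.
Proof. exact: mu_ext0 box_volume0 box_volume_ge0. Qed.

Let outer_ge0 A : (0 <= lebesgue_outer A)%E.
Proof. exact: mu_ext_ge0 box_volume_ge0 A. Qed.

Let le_outer : {homo lebesgue_outer : A B / A `<=` B >-> (A <= B)%E}.
Proof. exact: le_mu_ext. Qed.

Let outer_sigma_subadditive : sigma_subadditive lebesgue_outer.
Proof. exact: mu_ext_sigma_subadditive box_volume_ge0. Qed.

HB.instance Definition _ := isOuterMeasure.Build R box_space lebesgue_outer
  outer0 outer_ge0 le_outer outer_sigma_subadditive.

Definition lebesgue_space := caratheodory_type lebesgue_outer.

Definition lebesgue_rV : set lebesgue_space -> \bar R := lebesgue_outer.

Let lebesgue0 : lebesgue_rV set0 = 0%E.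
Proof. exact: outer_measure0. Qed.

Let lebesgue_ge0 A : (0 <= lebesgue_rV A)%E.
Proof. exact: outer_measure_ge0. Qed.

Let lebesgue_sigma_additive : semi_sigma_additive lebesgue_rV.
Proof.
exact: (@caratheodory_measure_sigma_additive R box_space lebesgue_outer).
Qed.

HB.instance Definition _ := isMeasure.Build _ lebesgue_space R lebesgue_rV
  lebesgue0 lebesgue_ge0 lebesgue_sigma_additive.

End lebesgue_measure_rV.

Arguments lebesgue_rV R n : clear implicits.

Section euclidean.
Variables (R : realType) (n : nat).

(* The library norm of ['rV[R]_n] is the sup norm (with the same topology). *)
Definition enorm (x : 'rV[R]_n) : R := Num.sqrt (\sum_(i < n) x 0 i ^+ 2).

Definition unit_ball : set 'rV[R]_n := [set x | enorm x < 1].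

Definition boundary (A : set 'rV[R]_n) : set 'rV[R]_n :=
  closure A `\` interior A.

Definition pderiv (i : 'I_n) (f : 'rV[R]_n -> R) : 'rV[R]_n -> R :=
  fun x => 'D_(delta_mx 0 i) f x.

Definition laplacian (f : 'rV[R]_n -> R) (x : 'rV[R]_n) : R :=
  \sum_(i < n) pderiv i (pderiv i f) x.

(* Meant for open [A]. *)
Definition C1_on (A : set 'rV[R]_n) (f : 'rV[R]_n -> R) : Prop :=
  {within A, continuous f} /\
  forall i : 'I_n, (forall x, A x -> derivable f x (delta_mx 0 i)) /\
    {within A, continuous (pderiv i f)}.

Definition C2_on (A : set 'rV[R]_n) (f : 'rV[R]_n -> R) : Prop :=
  C1_on A f /\ forall i : 'I_n, C1_on A (pderiv i f).

End euclidean.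

Arguments unit_ball R n : clear implicits.

Section equation.
Variables (R : realType) (n : nat).

(* R^n x R^n is identified with R^(n + n), so that joint measurability and
   integrability of the kernel refer to the Lebesgue measure of R^(2n). *)
Definition ball_kernel (K : 'rV[R]_n -> 'rV[R]_n -> R) : Prop :=
  [/\ (forall x y, unit_ball R n x -> unit_ball R n y -> 0 <= K x y),
      (lebesgue_rV R (n + n)).-integrable
        [set z : 'rV[R]_(n + n) |
          unit_ball R n (lsubmx z) /\ unit_ball R n (rsubmx z)]
        (fun z : 'rV[R]_(n + n) => (K (lsubmx z) (rsubmx z))%:E) &
      (ereal_sup [set \int[lebesgue_rV R n]_(y in unit_ball R n) (K x y)%:E |
                   x in unit_ball R n] < +oo)%E].

(* Only the values [u x t] with [x] in the closed ball and [0 <= t] matter. *)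
Definition classical (u : 'rV[R]_n -> R -> R) : Prop :=
  [/\ {within closure (unit_ball R n) `*` [set t : R | 0 <= t],
         continuous (fun p : 'rV[R]_n * R => u p.1 p.2)},
      (forall x, unit_ball R n x ->
         (forall t, 0 < t -> derivable (u x) t 1) /\
         {within [set t : R | 0 < t], continuous (derive1 (u x))}) &
      (forall t, 0 < t -> C2_on (unit_ball R n) (fun x => u x t))].

(* The equality in the extended reals entails that the integral is finite. *)
Definition solution (c Theta : R) (K : 'rV[R]_n -> 'rV[R]_n -> R)
    (u : 'rV[R]_n -> R -> R) : Prop :=
  classical u /\
  forall x t, unit_ball R n x -> 0 < t ->
    ((derive1 (u x) t)%:E = (c * laplacian (fun z => u z t) x)%:E +
      \int[lebesgue_rV R n]_(y in unit_ball R n)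
        (Num.max (u y t - Theta) 0 * K x y)%:E)%E.

End equation.

(* Main.v *)
Require Import Defs.
From mathcomp Require Import all_boot all_order all_algebra.
From mathcomp Require Import all_classical all_reals all_analysis.
From mathcomp Require Import ring lra.

Import Order.TTheory GRing.Theory Num.Theory.
Import numFieldNormedType.Exports.

Local Open Scope classical_set_scope.
Local Open Scope ring_scope.

(** The solution is compared with barriers W(x,t) = a(t) - b(t)|x|^2, whose
Laplacian is the constant -2nb(t). If a continuous function below W initially
and on the boundary ever reaches W, compactness gives a first time of contact,
attained at an interior point ([first_contact]). There the time derivative of
the solution is at least that of W ([derive1_ge0_at_left_max]) and its
Laplacian at most that of W ([laplacian_le_contact]), so an equation that W
strictly oversolves is contradicted ([barrier_comparison]).

Upper bound. Put w = lambda0 e^(-(2nc-C)t)(1-|x|^2). If u <= w + Theta at time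
t, then (u - Theta)_+ <= w, so the reaction term at time t is at most
lambda0 e^(-(2nc-C)t) C: the threshold absorbs any excess of size up to Theta.
Hence w + e(1+t) is a strict barrier on [0,T] as soon as e(1+T) <= Theta, and
e tends to 0 afterwards. The estimate of the reaction term only uses
monotonicity and homogeneity of the integral: a linearisation of the form
int (w + v) K <= int w K + int v K would require K(x,.) to be measurable at the
point of contact x, whereas joint integrability of K gives this only for almost
every x.

Limit. The reaction term is nonnegative, so -u is a subsolution of the heat
equation and stays below the decaying barrier M e^(-nct/2)(2-|x|^2), which is
positive up to the boundary. Thus u is squeezed between two functions tending
to 0, and the limit exists. *)

(** * Derivatives at a maximum *)

Lemma derive1_ge0_at_left_max (R : realFieldType) (h : R -> R) (a t : R) :
  a < t -> derivable h t 1 -> (forall s, a < s < t -> h s <= h t) ->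
  0 <= derive1 h t.
Proof.
move=> at_ dh hmax; rewrite derive1E /derive cvg_at_leftE; last exact: dh.
apply: limr_ge.
  rewrite /derivable in dh.
  rewrite -(cvg_at_leftE (fun z => z^-1 *: ((h \o shift t) _ - h t))) //.
  apply: cvg_trans dh; apply: cvg_app.
  move=> A [e egt0 Ae]; exists e => // x xe xgt0; apply: Ae => //.
  exact/ltr0_neq0.
near=> z; have z0 : z < 0 by near: z; exists 1 => /=.
apply: mulr_le0; first by rewrite invr_le0 ltW.
rewrite subr_le0 [_%:A]mulr1; apply: hmax; near: z.
exists (t - a); first by rewrite /= subr_gt0.
move=> z; rewrite /= sub0r normrN => + z0; rewrite ltr0_norm//.
by move=> ?; apply/andP; split; lra.
Unshelve. all: by end_near. Qed.

(** A positive second derivative would make the first one positive on an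
interval to the right of the critical point [c], hence [f] increasing there. *)
Lemma second_derive_le0_at_max (R : realType) (f f1 : R -> R) (f2 c : R) :
  (\forall s \near c, is_derive (s : R) 1 f (f1 s)) -> is_derive c 1 f1 f2 ->
  (\forall s \near c, f s <= f c) -> f2 <= 0.
Proof.
move=> df ddf fmax.
have : \forall s \near c, is_derive (s : R) 1 f (f1 s) /\ f s <= f c.
  by near=> s; split; near: s.
move=> /nbhs_ballP[d /= d0 fd].
have inb (s : R) : c - d < s < c + d -> is_derive s 1 f (f1 s) /\ f s <= f c.
  by move=> sd; apply: fd; rewrite /ball/= distrC ltr_distl.
have f1c : f1 c = 0.
  have [dfc _] := inb c ltac:(lra); rewrite -(@derive_val _ _ _ _ _ _ _ dfc).
  apply: derive_val; apply: (@derive1_at_max _ f (c - d) (c + d)).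
  - lra.
  - by move=> s; rewrite in_itv/= => /inb[[]].
  - by rewrite in_itv/=; lra.
  - by move=> s; rewrite in_itv/= => /inb[].
rewrite leNgt; apply/negP => H.
have [cvf1 f1E] := ddf; rewrite -f1E in H; have := cvgr_gt _ cvf1 _ H.
rewrite near_withinE => /(_ _)/nbhs_ballP[e /= e0 fe].
pose r := Num.min (d / 2) (e / 2).
have r0 : 0 < r by rewrite /r lt_min; apply/andP; split; lra.
have rd : r < d by rewrite /r gt_min; apply/orP; left; lra.
have re : r < e by rewrite /r gt_min; apply/orP; right; lra.
have f1_gt0 (s : R) : c < s < c + r -> 0 < f1 s.
  move=> /andP[cs sr].
  have /(_ _)/= := fe (s - c); rewrite /ball/= sub0r normrN gtr0_norm; last lra.
  rewrite f1c subr0 [X in f1 X](_ : _ = s); last by rewrite /GRing.scale/=; lra.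
  move=> /(_ ltac:(lra) ltac:(by rewrite subr_eq0 gt_eqF)).
  by rewrite /GRing.scale/= pmulr_rgt0// invr_gt0 subr_gt0.
have dfr (s : R) : s \in `]c, c + r[ -> is_derive s 1 f (f1 s).
  by rewrite in_itv/= => sr; apply: (inb _ _).1; lra.
have cf : {within `[c, c + r], continuous f}.
  apply: derivable_within_continuous => s; rewrite in_itv/= => sr.
  by have [[]] := inb s ltac:(lra).
have [z zcr fz] := MVT (ltac:(lra) : c < c + r) dfr cf.
have := (inb (c + r) ltac:(lra)).2.
by rewrite -subr_le0 fz leNgt mulr_gt0 ?f1_gt0//; lra.
Unshelve. all: by end_near. Qed.

(** * The integral of a possibly non-measurable function *)

Section lower_integral.
Import HBNNSimple.
(** Without measurability the integral of a nonnegative function is the supremum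
of the integrals of the simple functions below it. Such a lower integral is
not additive, but a simple function [h] below [f] still yields the simple
function [k^-1 * h] below [g]. *)
Lemma ge0_le_integral_scale d (T : measurableType d) (R : realType)
    (mu : {measure set T -> \bar R}) (D : set T) (k : R) (f g : T -> R) :
  0 < k -> (forall x, D x -> 0 <= f x) -> (forall x, D x -> f x <= k * g x) ->
  (\int[mu]_(x in D) (f x)%:E <= k%:E * \int[mu]_(x in D) (g x)%:E)%E.
Proof.
move=> k0 f0 fg.
have g0 x : D x -> 0 <= g x.
  by move=> Dx; have := le_trans (f0 _ Dx) (fg _ Dx); rewrite pmulr_rge0.
rewrite !ge0_integralE; [|by move=> x Dx; rewrite lee_fin; auto..].
apply: ge_ereal_sup => _ [h /= hf <-].
have k0' : 0 <= k^-1 by rewrite invr_ge0 ltW.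
have -> : sintegral mu h = (k%:E * sintegral mu (scale_nnsfun h k0'))%E.
  by rewrite sintegralrM muleA -EFinM divff ?gt_eqF// mul1e.
rewrite lee_pmul2l//; apply: ereal_sup_ubound;
  exists (scale_nnsfun h k0') => //= x.
have := hf x; rewrite /patch; case: ifPn => [/set_mem Dx|_]; rewrite !lee_fin.
  by move=> /le_trans/(_ (fg _ Dx)) hg; rewrite /cst ler_pdivrMl.
by move=> h0; rewrite pmulr_rle0// invr_gt0.
Qed.
End lower_integral.

(** * The Euclidean unit ball *)

Section unit_ball_topology.
Variables (R : realType) (n : nat).
Implicit Types x : 'rV[R]_n.
Local Notation B := (unit_ball R n).

Lemma enorm_sqr x : enorm x ^+ 2 = \sum_(i < n) x 0 i ^+ 2.
Proof. by rewrite /enorm sqr_sqrtr// sumr_ge0// => i _; rewrite sqr_ge0. Qed.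

Lemma enorm_ge0 x : 0 <= enorm x.
Proof. exact: sqrtr_ge0. Qed.

Lemma continuous_enorm_sqr : continuous (fun x => enorm x ^+ 2).
Proof.
rewrite (_ : (fun x => _) = (fun x => \sum_(i < n) x 0 i ^+ 2)); last first.
  by apply/funext => y; exact: enorm_sqr.
apply: continuous_big => [|i _ x]; first exact: add_continuous.
have xi := @coord_continuous R 1 n 0 i x.
exact: (continuous_comp xi (@exprn_continuous R 2 _)).
Qed.

Lemma unit_ballE x : B x <-> enorm x ^+ 2 < 1.
Proof. by rewrite /unit_ball/= expr_lt1// enorm_ge0. Qed.

Lemma open_unit_ball : open B.
Proof.
rewrite (_ : B = (fun x => enorm x ^+ 2) @^-1` [set r | r < 1]); last first.
  by apply/seteqP; split=> x /unit_ballE.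
by apply: open_comp; [move=> x _; exact: continuous_enorm_sqr|exact: open_lt].
Qed.

Lemma closure_unit_ball_le1 x : closure B x -> enorm x ^+ 2 <= 1.
Proof.
move=> Bx; have : closed ((fun x => enorm x ^+ 2) @^-1` [set r : R | r <= 1]).
  by apply: closed_comp; [move=> y _; exact: continuous_enorm_sqr|exact: closed_le].
move=> /closure_id => E.
have : closure ((fun x => enorm x ^+ 2) @^-1` [set r : R | r <= 1]) x.
  by apply: closure_subset Bx => y /unit_ballE/ltW.
by rewrite -E.
Qed.

Lemma boundary_unit_ballP x : boundary B x <-> closure B x /\ ~ B x.
Proof.
by rewrite /boundary (interior_id _).1 //; exact: open_unit_ball.
Qed.

Lemma enorm_boundary x : boundary B x -> enorm x ^+ 2 = 1.
Proof.
move=> /boundary_unit_ballP[/closure_unit_ball_le1 x1 /unit_ballE /negP].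
by rewrite -leNgt => x1'; apply/eqP; rewrite eq_le x1 x1'.
Qed.

Lemma compact_closure_unit_ball : compact (closure B).
Proof.
apply: bounded_closed_compact; last exact: closed_closure.
exists 1; split=> // M M1 x /closure_unit_ball_le1 x1.
rewrite /= [leLHS]/Num.norm/= mx_normrE.
apply: bigmax_le => [|[i j] _ /=]; first by lra.
rewrite ord1; apply: le_trans (ltW M1).
rewrite -(@ler_pXn2r _ 2)// ?nnegrE// expr1n real_normK ?num_real//.
apply: le_trans x1; rewrite enorm_sqr (bigD1 j)//= lerDl.
by apply: sumr_ge0 => k _; rewrite sqr_ge0.
Qed.

Lemma enorm_sqr_line x (i : 'I_n) (s : R) :
  enorm (s *: delta_mx 0 i + x) ^+ 2 = enorm x ^+ 2 + 2 * x 0 i * s + s ^+ 2.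
Proof.
rewrite !enorm_sqr (bigD1 i)//= [in RHS](bigD1 i)//= !mxE !eqxx mulr1.
rewrite (@eq_bigr _ _ _ _ _ _ _ (fun j => x 0 j ^+ 2)); first by ring.
by move=> j /negbTE ji; rewrite !mxE ji andbF mulr0 add0r.
Qed.

End unit_ball_topology.

(** * Contact with a paraboloid *)

Lemma is_derive_line (R : realType) (V : normedModType R) (f : V -> R)
    (x v : V) (s : R) :
  derivable f (s *: v + x) v ->
  is_derive s 1 (fun r => f (r *: v + x)) ('D_v f (s *: v + x)).
Proof.
have E : (fun h : R => h^-1 *: (((fun r => f (r *: v + x)) \o shift s) (h *: 1)
           - (fun r => f (r *: v + x)) s)) =
         (fun h => h^-1 *: ((f \o shift (s *: v + x)) (h *: v) - f (s *: v + x))).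
  apply/funext => h /=; congr (_ *: (f _ - _)).
  by rewrite scalerDl addrA /GRing.scale/= mulr1.
by move=> df; split; rewrite /derivable /derive E.
Qed.

Section contact.
Variables (R : realType) (n : nat).
Implicit Types x : 'rV[R]_n.
Local Notation B := (unit_ball R n).

(** Along each coordinate line the difference with the paraboloid has a maximum
at [x], where its second derivative is [k] times that of [f] plus [2 * b].
The factor [k] is there to treat [f] and [- f] at once. *)
Lemma laplacian_le_contact (f : 'rV[R]_n -> R) (k a b : R) x :
  C2_on B f -> B x -> k * f x = a - b * enorm x ^+ 2 ->
  (forall y, B y -> k * f y <= a - b * enorm y ^+ 2) ->
  k * laplacian f x <= - (2 * n%:R * b).
Proof.
move=> [[_ df] ddf] Bx fx fle.
suff H i : k * pderiv i (pderiv i f) x <= - (2 * b).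
  rewrite mulr_sumr; apply: le_trans (ler_sum _ (fun i _ => H i)) _.
  by rewrite sumr_const card_ord -[leLHS]mulr_natr; lra.
pose e : 'rV[R]_n := delta_mx 0 i.
have Bnear : \forall s \near (0 : R), B (s *: e + x).
  have : (fun s : R => s *: e + x) @ 0 --> x.
    rewrite -[X in _ --> X]add0r -(scale0r e).
    by apply: cvgD; [exact: scalel_continuous|exact: cvg_cst].
  by apply; apply: open_nbhs_nbhs; split => //; exact: open_unit_ball.
(* [p s] is the increment of [b * enorm y ^+ 2] along the line. *)
pose p s := 2 * b * x 0 i * s + b * s ^+ 2.
have dp (s : R) : is_derive s 1 p (2 * b * x 0 i + 2 * b * s).
  by rewrite /p; apply: is_derive_eq; rewrite /GRing.scale/=; ring.
have dp1 : is_derive (0 : R) 1 (fun s => 2 * b * x 0 i + 2 * b * s) (2 * b).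
  by apply: is_derive_eq; rewrite /GRing.scale/=; ring.
suff : k * pderiv i (pderiv i f) x + 2 * b <= 0 by lra.
apply: (@second_derive_le0_at_max R (fun s => k * f (s *: e + x) + p s)
  (fun s => k * pderiv i f (s *: e + x) + (2 * b * x 0 i + 2 * b * s)) _ 0).
- near=> s; have Bs : B (s *: e + x) by near: s.
  apply: is_deriveD; [|exact: dp].
  exact: is_deriveZ (@is_derive_line R _ f x e s ((df i).1 _ Bs)).
- apply: is_deriveD; have := @is_derive_line R _ (pderiv i f) x e 0.
  rewrite scale0r add0r => /(_ (((ddf i).2 i).1 _ Bx)) d2f.
  exact: is_deriveZ d2f.
- near=> s; have Bs : B (s *: e + x) by near: s.
  rewrite scale0r add0r fx {2}/p mulr0 expr0n mulr0 !addr0.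
  by have := fle _ Bs; rewrite enorm_sqr_line /p; lra.
Unshelve. all: by end_near. Qed.

(** The points where [g >= 0] form a compact set; one of minimal time lies off
the initial slice and the lateral boundary, where [g < 0]. *)
Lemma first_contact (g : 'rV[R]_n -> R -> R) (x1 : 'rV[R]_n) (t1 : R) :
  {within closure B `*` [set t : R | 0 <= t],
     continuous (fun p : 'rV[R]_n * R => g p.1 p.2)} ->
  (forall x, closure B x -> g x 0 < 0) ->
  (forall x t, boundary B x -> 0 <= t <= t1 -> g x t < 0) ->
  closure B x1 -> 0 <= t1 -> 0 <= g x1 t1 ->
  exists x t, [/\ B x, 0 < t <= t1, 0 <= g x t &
    forall y s, closure B y -> 0 <= s < t -> g y s < 0].
Proof.
move=> cg g0 gb Bx1 t10 gx1.
pose Q : set ('rV[R]_n * R) := closure B `*` `[0, t1].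
have cQ : compact Q.
  by apply: compact_setX; [exact: compact_closure_unit_ball|exact: segment_compact].
have cgQ : {within Q, continuous (fun p : 'rV[R]_n * R => g p.1 p.2)}.
  apply: continuous_subspaceW cg => -[x t] [/= Bx]; rewrite in_itv/= => /andP[t0 _].
  by split.
pose P : set ('rV[R]_n * R) := [set p | 0 <= g p.1 p.2].
have cP : compact (Q `&` P).
  have /closed_subspaceP[V cV VQ] : closed (P : set (subspace Q)).
    by move/continuous_closedP : cgQ => /(_ _ (@closed_ge R 0)).
  by rewrite setIC -VQ setIC; exact: compact_closedI.
have P0 : Q `&` P !=set0.
  by exists (x1, t1); split => //; split => //=; rewrite in_itv/= t10 lexx.
have csnd : {within Q `&` P, continuous (snd : 'rV[R]_n * R -> R)}.
  by apply: continuous_subspaceT => z; exact: cvg_snd.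
have [[x t]/=] := compact_EVT_min P0 cP csnd.
rewrite inE => -[[/= Bx]]; rewrite in_itv/= => /andP[t0 tt1] gxt tmin.
have {}t0 : 0 < t.
  rewrite lt_neqAle t0 andbT; apply/eqP => t0'.
  by move: gxt; rewrite /P/= -t0' leNgt g0.
exists x, t; split => //.
- apply: contrapT => nBx; move: gxt; rewrite /P/= leNgt gb//.
    exact/boundary_unit_ballP.
  by rewrite ltW.
- by rewrite t0.
- move=> y s By /andP[s0 st]; rewrite ltNge; apply/negP => gys.
  have := tmin (y, s); rewrite inE/= => tmin'.
  have : t <= s; last by rewrite leNgt st.
  apply: tmin'; split => //; split => //=.
  by rewrite in_itv/= s0 (le_trans (ltW st)).
Qed.
End contact.

(** * Comparison with a barrier *)

(** The differential inequality is asked of [k * u] only at times when [k * u]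
lies below the barrier on the whole ball: this is what lets a nonlocal term be
estimated there. It fails at a first contact, where [k * u] minus the barrier
has a nonnegative time derivative and a nonpositive Laplacian. *)
Lemma barrier_comparison (R : realType) (n : nat) (c k T : R)
    (u : 'rV[R]_n -> R -> R) (a b a' b' : R -> R) :
  0 <= c -> classical u ->
  (forall t : R, is_derive t 1 a (a' t)) ->
  (forall t : R, is_derive t 1 b (b' t)) ->
  (forall x, closure (unit_ball R n) x ->
     k * u x 0 < a 0 - b 0 * enorm x ^+ 2) ->
  (forall x t, boundary (unit_ball R n) x -> 0 <= t <= T ->
     k * u x t < a t - b t * enorm x ^+ 2) ->
  (forall x t, unit_ball R n x -> 0 < t <= T ->
     (forall y, unit_ball R n y -> k * u y t <= a t - b t * enorm y ^+ 2) ->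
     k * derive1 (u x) t <
       c * (k * laplacian (fun z => u z t) x + 2 * n%:R * b t) +
       (a' t - b' t * enorm x ^+ 2)) ->
  forall x t, closure (unit_ball R n) x -> 0 <= t <= T ->
    k * u x t < a t - b t * enorm x ^+ 2.
Proof.
move=> c0 [cu du C2u] da db init bdry super x1 t1 Bx1 /andP[t10 t1T].
rewrite ltNge; apply/negP => contact1.
pose g x t := k * u x t - (a t - b t * enorm x ^+ 2).
have ca : continuous a.
  by move=> t; apply/differentiable_continuous/derivable1_diffP; case: (da t).
have cb : continuous b.
  by move=> t; apply/differentiable_continuous/derivable1_diffP; case: (db t).
have cg : {within closure (unit_ball R n) `*` [set t : R | 0 <= t],
    continuous (fun p : 'rV[R]_n * R => g p.1 p.2)}.
  apply: within_continuousB.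
    by move=> p; apply: cvgM; [exact: cvg_cst|exact: cu].
  apply: continuous_subspaceT => p; apply: cvgB.
    by apply: continuous_comp; [exact: cvg_snd|exact: ca].
  apply: cvgM.
    by apply: continuous_comp; [exact: cvg_snd|exact: cb].
  apply: (@continuous_comp _ _ _ fst (fun x : 'rV[R]_n => enorm x ^+ 2)).
    exact: cvg_fst.
  exact: continuous_enorm_sqr.
have [|||||x [t [Bx /andP[t0 tt1] gxt gneg]]] := @first_contact R n g x1 t1 cg.
- by move=> x Bx; rewrite subr_lt0 init.
- move=> x t Bx /andP[t0 tt1]; rewrite subr_lt0 bdry// t0/=.
  exact: le_trans t1T.
- by [].
- by [].
- by rewrite subr_ge0.
have dg y : unit_ball R n y ->
    is_derive t 1 (g y) (k * derive1 (u y) t - (a' t - b' t * enorm y ^+ 2)).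
  move=> By; have duy : is_derive t 1 (u y) (derive1 (u y) t).
    by rewrite derive1E; apply: derivableP; exact: (du y By).1.
  rewrite /g; apply: is_derive_eq; rewrite /GRing.scale/=; ring.
have g_le0 y : unit_ball R n y -> g y t <= 0.
  move=> By; have [/derivable1_diffP/differentiable_continuous cgy _] := dg y By.
  have cgy' : g y s @[s --> t^'-] --> g y t by exact: cvg_at_left_filter cgy.
  rewrite -(cvg_lim (@Rhausdorff R) cgy'); apply: limr_le; first exact: cvgP cgy'.
  near=> s; apply/ltW/gneg; first exact: subset_closure.
  by apply/andP; split; [apply: ltW|]; near: s;
    [exact: nbhs_left_gt|exact: nbhs_left_lt].
have k_le y : unit_ball R n y -> k * u y t <= a t - b t * enorm y ^+ 2.
  by move=> /g_le0; rewrite subr_le0.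
have dg_ge0 : 0 <= derive1 (g x) t.
  apply: (@derive1_ge0_at_left_max R _ 0) => //; first by case: (dg x Bx).
  move=> s /andP[s0 st]; apply: ltW; apply: lt_le_trans gxt.
  by apply: gneg; [exact: subset_closure|rewrite ltW].
have eq_xt : k * u x t = a t - b t * enorm x ^+ 2.
  by apply/eqP; rewrite eq_le k_le// -subr_ge0.
have lap := laplacian_le_contact _ _ _ _ _ _ _ (C2u t t0) Bx eq_xt k_le.
have := super x t Bx _ k_le; rewrite t0 (le_trans tt1)// => /(_ isT).
rewrite derive1E in dg_ge0; rewrite (@derive_val _ _ _ _ _ _ _ (dg x Bx)) in dg_ge0.
have : c * (k * laplacian (fun z => u z t) x + 2 * n%:R * b t) <= 0.
  by rewrite mulr_ge0_le0//; lra.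
lra.
Unshelve. all: by end_near. Qed.

(** * Bounds on the solution *)

(** A profile [l * (1 - enorm y ^+ 2)] exceeded by at most [Theta] already
dominates the positive part, so that the excess contributes nothing. *)
Lemma reaction_term_le (R : realType) (n : nat)
    (K : 'rV[R]_n -> 'rV[R]_n -> R) (C Theta l : R) (v : 'rV[R]_n -> R) x :
  (forall y, unit_ball R n y -> 0 <= K x y) -> unit_ball R n x -> 0 < l ->
  ereal_sup [set (\int[lebesgue_rV R n]_(y in unit_ball R n)
                           ((1 - enorm y ^+ 2) * K x y)%:E)%E |
                      x in unit_ball R n] = C%:E ->
  (forall y, unit_ball R n y -> v y <= l * (1 - enorm y ^+ 2) + Theta) ->
  (\int[lebesgue_rV R n]_(y in unit_ball R n)
     (Num.max (v y - Theta) 0 * K x y)%:E <= (l * C)%:E)%E.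
Proof.
move=> K0 Bx l0 hC vle; rewrite EFinM.
apply: (@le_trans _ _ (l%:E * \int[lebesgue_rV R n]_(y in unit_ball R n)
                           ((1 - enorm y ^+ 2) * K x y)%:E)%E); last first.
  by rewrite lee_pmul2l// -hC; apply: ereal_sup_ubound; exists x.
apply: ge0_le_integral_scale => // y By.
  by rewrite mulr_ge0 ?K0// le_max lexx orbT.
rewrite mulrA ler_wpM2r ?K0// ge_max lerBlDr vle//=.
by rewrite mulr_ge0 ?ltW// subr_gt0; exact/unit_ballE.
Qed.

Lemma is_derive_expRM (R : realType) (m s : R) :
  is_derive s 1 (fun s : R => expR (m * s)) (m * expR (m * s)).
Proof. by apply: is_derive_eq; rewrite /GRing.scale/=; ring. Qed.

(** The barrier is the claimed bound plus [e * (1 + s)], with [e] so small that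
the excess stays below [Theta] up to time [t]; its growth at rate [e] makes the
comparison strict. *)
Lemma solution_le (R : realType) (n : nat) (c Theta : R)
    (K : 'rV[R]_n -> 'rV[R]_n -> R) (u : 'rV[R]_n -> R -> R)
    (lambda0 C : R) x (t : R) :
  ball_kernel K -> solution c Theta K u ->
  (forall x (t : R), boundary (unit_ball R n) x -> 0 <= t -> u x t = 0) ->
  0 < c -> 0 < lambda0 -> 0 < Theta ->
  ereal_sup [set (\int[lebesgue_rV R n]_(y in unit_ball R n)
                           ((1 - enorm y ^+ 2) * K x y)%:E)%E |
                      x in unit_ball R n] = C%:E ->
  (forall x, unit_ball R n x -> u x 0 <= lambda0 * (1 - enorm x ^+ 2)) ->
  0 < 2 * n%:R * c - C ->
  unit_ball R n x -> 0 <= t ->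
     u x t <= lambda0 * expR (- (2 * n%:R * c - C) * t) * (1 - enorm x ^+ 2).
Proof.
move=> hK hu hbd c0 l0 Th0 hC hinit kap0 Bx t0.
set m := - (2 * n%:R * c - C).
suff H (d : R) : 0 < d -> d <= Theta ->
    u x t <= lambda0 * expR (m * t) * (1 - enorm x ^+ 2) + d.
  apply/ler_addgt0Pr => d d0; have [dT|/ltW Td] := leP d Theta; first exact: H.
  by apply: (le_trans (H _ Th0 (lexx _))); rewrite lerD2l.
(* This choice makes the excess [e * (1 + s)] equal to [d] at [s = t]. *)
move=> d0 dT; pose e := d / (1 + t).
have t1 : 0 < 1 + t by lra.
have e0 : 0 < e by rewrite divr_gt0.
have eT s : s <= t -> e * (1 + s) <= Theta.
  move=> st; apply: le_trans dT; rewrite /e mulrAC ler_pdivrMr// ler_pM2l//; lra.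
pose b s : R := lambda0 * expR (m * s).
pose a s : R := b s + e * (1 + s).
have b0 s : 0 < b s by rewrite mulr_gt0// expR_gt0.
have db (s : R) : is_derive s 1 b (m * b s).
  have := is_derive_expRM R m s => de.
  by rewrite /b; apply: is_derive_eq; rewrite /GRing.scale/=; ring.
have da (s : R) : is_derive s 1 a (m * b s + e).
  by rewrite /a; apply: is_derive_eq; rewrite /GRing.scale/=; ring.
have [hcl heq] := hu; have [K0 _ _] := hK.
have bdry y s : boundary (unit_ball R n) y -> 0 <= s <= t ->
    1 * u y s < a s - b s * enorm y ^+ 2.
  move=> By /andP[s0 _]; rewrite mul1r hbd// enorm_boundary// /a.
  have : 0 < e * (1 + s) by rewrite mulr_gt0//; lra.
  lra.
have := @barrier_comparison R n c 1 t u a b _ _ (ltW c0) hcl da db _ bdry _ x t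
  (subset_closure Bx).
rewrite mul1r t0 lexx => /(_ _ _ isT)/ltW H; apply: le_trans (H _ _) _.
- move=> y cBy; have [By|nBy] := pselect (unit_ball R n y); last first.
    by apply: bdry; [exact/boundary_unit_ballP|rewrite lexx].
  rewrite mul1r; have := hinit y By; rewrite /a /b mulr0 expR0; lra.
- move=> y s By /andP[s0 st] le_s.
  have le_s' z : unit_ball R n z -> u z s <= b s * (1 - enorm z ^+ 2) + Theta.
    move=> Bz; have := le_s z Bz; have := eT s st; rewrite mul1r /a; lra.
  have := heq y s By s0.
  have := reaction_term_le R n K C Theta (b s) (u^~ s) y (K0 y ^~ By) By
    (b0 s) hC le_s'.
  move=> /(leeD2l (c * laplacian (u^~ s) y)%:E) => I E; rewrite -E -EFinD lee_fin in I.
  rewrite !mul1r; apply: le_lt_trans I _.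
  have : 0 <= (- m) * b s * enorm y ^+ 2.
    have m0 : 0 <= - m by rewrite /m opprK ltW.
    by rewrite mulr_ge0 ?sqr_ge0// mulr_ge0// ltW.
  rewrite /m; lra.
- by rewrite /a /b /e divfK ?gt_eqF//; lra.
Qed.

(** The reaction term is nonnegative, so that [- u] is a subsolution of the heat
equation. Its barrier [M * expR (- (n * c / 2) * t) * (2 - enorm x ^+ 2)] is at
least [M] initially and positive on the boundary. As [2 - enorm x ^+ 2 <= 2],
the decay at rate [n * c / 2] costs at most half of the gain [2 * n * c] that
comes from the Laplacian. *)
Lemma solution_ge (R : realType) (n : nat) (c Theta : R)
    (K : 'rV[R]_n -> 'rV[R]_n -> R) (u : 'rV[R]_n -> R -> R) :
  ball_kernel K -> solution c Theta K u ->
  (forall x (t : R), boundary (unit_ball R n) x -> 0 <= t -> u x t = 0) ->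
  (0 < n)%N -> 0 < c -> exists M : R, forall x t,
  unit_ball R n x -> 0 <= t ->
  - (M * expR (- (n%:R * c / 2) * t)) <= u x t.
Proof.
move=> hK hu hbd hn c0.
have [hcl heq] := hu; have [cu _ _] := hcl; have [K0 _ _] := hK.
have n0 : 0 < n%:R :> R by rewrite ltr0n.
have [M M0 hM] : exists2 M : R, 0 < M &
    forall x, closure (unit_ball R n) x -> - u x 0 < M.
  have cQ : compact (closure (unit_ball R n) `*` [set (0 : R)]).
    by apply: compact_setX; [exact: compact_closure_unit_ball|exact: compact_set1].
  have cuQ : {within closure (unit_ball R n) `*` [set (0 : R)],
       continuous (fun p : 'rV[R]_n * R => u p.1 p.2)}.
    by apply: continuous_subspaceW cu => -[x t] [/= Bx ->]; split => //=.
  have /compact_bounded/ex_strict_bound_gt0[M M0 hM] := continuous_compact cuQ cQ.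
  exists M => // x Bx; apply: (@le_lt_trans _ _ `|u x 0|).
    by rewrite -normrN ler_norm.
  by apply: hM; exists (x, 0).
pose m := - (n%:R * c / 2).
pose b s : R := M * expR (m * s).
pose a s : R := 2 * b s.
have b0 s : 0 < b s by rewrite mulr_gt0// expR_gt0.
have db (s : R) : is_derive s 1 b (m * b s).
  have := is_derive_expRM R m s => de.
  by rewrite /b; apply: is_derive_eq; rewrite /GRing.scale/=; ring.
have da (s : R) : is_derive s 1 a (2 * (m * b s)).
  by rewrite /a; apply: is_derive_eq; rewrite /GRing.scale/=; ring.
exists (2 * M) => x t Bx t0.
have bdry y s : boundary (unit_ball R n) y -> 0 <= s <= t ->
    -1 * u y s < a s - b s * enorm y ^+ 2.
  move=> By /andP[s0 _]; rewrite hbd// enorm_boundary// /a.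
  by have := b0 s; lra.
have := @barrier_comparison R n c (-1) t u a b _ _ (ltW c0) hcl da db _ bdry _ x t
  (subset_closure Bx).
rewrite t0 lexx => /(_ _ _ isT)/ltW H.
have {}H := H _ _; have : 0 <= b t * enorm x ^+ 2.
  by rewrite mulr_ge0 ?sqr_ge0// ltW.
suff : -1 * u x t <= a t - b t * enorm x ^+ 2 by rewrite /a /b /m; lra.
apply: H.
- move=> y cBy; have y1 := @closure_unit_ball_le1 R n y cBy.
  have : M * enorm y ^+ 2 <= M by rewrite ler_piMr// ltW.
  by have := hM y cBy; rewrite /a /b mulr0 expR0; lra.
- move=> y s By /andP[s0 st] le_s.
  have I : (0 <= \int[lebesgue_rV R n]_(z in unit_ball R n)
        (Num.max (u z s - Theta) 0 * K y z)%:E)%E.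
    apply: integral_ge0 => z Bz.
    by rewrite lee_fin mulr_ge0 ?K0// le_max lexx orbT.
  have {I} := leeD2l (c * laplacian (u^~ s) y)%:E I.
  rewrite -(heq y s By s0) adde0 lee_fin => I.
  have : 0 <= n%:R * c / 2 * b s * enorm y ^+ 2.
    by rewrite mulr_ge0 ?sqr_ge0// mulr_ge0 ?ltW// divr_gt0 ?mulr_gt0.
  have : 0 < n%:R * c * b s by exact: (mulr_gt0 (mulr_gt0 n0 c0) (b0 s)).
  rewrite /m; lra.
Qed.
Theorem theorem2p4 (R : realType) (n : nat) (hn : (0 < n)%N)
    (c : R) (hc : 0 < c)
    (K : 'rV[R]_n -> 'rV[R]_n -> R) (hK : ball_kernel K)
    (lambda0 Theta : R) (hTheta : 0 < Theta) (hlambda0 : Theta < lambda0)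
    (C : R)
    (hC : ereal_sup [set (\int[lebesgue_rV R n]_(y in unit_ball R n)
                           ((1 - enorm y ^+ 2) * K x y)%:E)%E |
                      x in unit_ball R n] = C%:E)
    (u : 'rV[R]_n -> R -> R) (hu : solution c Theta K u)
    (hbd : forall x (t : R), boundary (unit_ball R n) x -> 0 <= t -> u x t = 0)
    (hinit : forall x, unit_ball R n x ->
       u x 0 <= lambda0 * (1 - enorm x ^+ 2))
    (hcC : C / (2 * n%:R) < c) :
  (forall x, unit_ball R n x ->
     exists2 l : R, u x t @[t --> +oo] --> l & l <= 0) /\
  (forall x (t : R), unit_ball R n x -> 0 <= t ->
     u x t <= lambda0 * expR (- (2 * n%:R * c - C) * t) * (1 - enorm x ^+ 2)).
Proof.
have n0 : 0 < n%:R :> R by rewrite ltr0n.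
have kap0 : 0 < 2 * n%:R * c - C.
  by move: hcC; rewrite ltr_pdivrMr ?mulr_gt0//; lra.
have upper x (t : R) : unit_ball R n x -> 0 <= t ->
     u x t <= lambda0 * expR (- (2 * n%:R * c - C) * t) * (1 - enorm x ^+ 2).
  by move=> *; apply: (solution_le R n c Theta K) => //; lra.
split=> // x Bx; exists 0 => //.
have [M lower] := solution_ge R n c Theta K u hK hu hbd hn hc.
have decay (k r : R) : 0 < k -> r * expR (- k * t) @[t --> +oo] --> (0 : R).
  move=> k0; rewrite -[X in _ --> X](mulr0 r); apply: cvgMr.
  under eq_fun do rewrite mulNr.
  apply: (@cvg_comp _ _ _ (fun t => k * t) (fun t => expR (- t)) _ +oo); last first.
    exact: cvgr_expR.
  apply/cvgryPge => A; apply: filterS (nbhs_pinfty_ge (num_real (k^-1 * A))) => t.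
  by rewrite ler_pdivrMl.
have dn : 0 < n%:R * c / 2 by rewrite divr_gt0 ?mulr_gt0.
have lo : - (M * expR (- (n%:R * c / 2) * t)) @[t --> +oo] --> (0 : R).
  by rewrite -oppr0; apply: cvgN; exact: decay.
apply: squeeze_cvgr lo (decay _ (lambda0 * (1 - enorm x ^+ 2)) kap0).
near=> t; have t0 : 0 <= t by near: t; exact: nbhs_pinfty_ge.
by rewrite lower//= mulrAC upper.
Unshelve. all: by end_near. Qed.
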